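(* Let $S$ be a Prüfer (in particular, a Dedekind) semidomain and let $M$ be a subtractive $S$-semimodule. Then $S$ is $M$-Gaussian, i.e. $c(fg)=c(f)c(g)$ for all $f\in S[X]$ and $g\in M[X]$.
   Context: A semiring is $(S,+,\cdot,0,1)$ where $(S,+,0)$ and $(S,\cdot,1)$ are commutative monoids, $1\neq 0$, multiplication distributes over addition, and $a\cdot 0=0$ for all $a$. A semidomain is a semiring $S$ in which $ab=ac$ with $a\neq 0$ implies $b=c$. Its semifield of fractions $K=F(S)$ is the localization of $S$ at $S-\{0\}$. An (integral) ideal of $S$ is a nonempty subset of $S$ closed under addition and under multiplication by elements of $S$. A fractional ideal of $S$ is a nonempty subset $A\subseteq K$ closed under addition and under multiplication by elements of $S$ such that $dA\subseteq S$ for some nonzero $d\in S$. The product of fractional ideals $A,B$ is $AB=\{\sum_{i=1}^n a_ib_i: a_i\in A, b_i\in B\}$, and $A$ is invertible if $AB=S$ for some fractional ideal $B$. A Prüfer semidomain is a semidomain in which each nonzero finitely generated integral ideal is invertible; a Dedekind semidomain is a semidomain in which each nonzero fractional ideal is invertible. An $S$-semimodule is a commutative monoid $(M,+,0)$ with a scalar multiplication $S\times M\to M$ that is additive in each variable, associative with respect to multiplication in $S$, and satisfies $1m=m$, $0m=0$, $s0=0$. An $S$-subsemimodule $N$ of $M$ is subtractive if $x+y\in N$ and $x\in N$ imply $y\in N$ for all $x,y\in M$; $M$ is subtractive if each of its $S$-subsemimodules is subtractive. $S[X]$ is the semiring of polynomials over $S$, and $M[X]$ is the $S[X]$-semimodule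 of polynomials with coefficients in $M$, with the usual operations. For $g\in M[X]$, the content $c(g)$ is the $S$-subsemimodule of $M$ generated by the coefficients of $g$; for $f\in S[X]$, $c(f)$ is the ideal of $S$ generated by the coefficients of $f$. For an ideal $\mathfrak{a}$ of $S$ and a subsemimodule $N$ of $M$, $\mathfrak{a}N$ is the set of finite sums $\sum a_in_i$ with $a_i\in\mathfrak{a}$, $n_i\in N$. *)

(* Defs.v *)
From HB Require Import structures.
From mathcomp Require Import all_boot all_algebra finmap all_classical.

Set Implicit Arguments.
Unset Strict Implicit.
Unset Printing Implicit Defensive.

Import GRing.Theory.
Local Open Scope classical_set_scope.
Local Open Scope ring_scope.

HB.mixin Record ComNzSemiRing_isSemidomain S of GRing.ComNzSemiRing S := {
  semidom_mulfI : forall a : S, a != 0 -> injective ( *%R a)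
}.

#[short(type="semidomainType")]
HB.structure Definition Semidomain :=
  { S of GRing.ComNzSemiRing S & ComNzSemiRing_isSemidomain S }.

Arguments semidom_mulfI {s a} _ [x1 x2] _.

Lemma semidom_mulf_neq0 (S : semidomainType) (a b : S) :
  a != 0 -> b != 0 -> a * b != 0.
Proof.
move=> a0; apply: contra_neq => ab0; apply: (semidom_mulfI a0).
by rewrite ab0 mulr0.
Qed.

(* The semifield of fractions.  The construction follows mathcomp's           *)
(* {fraction R}, which is only available when R has opposites.                *)
Module SemiFrac.
Section SemiFrac.
Context (S : semidomainType).
Local Open Scope quotient_scope.

Record ratio := MkRatio { frac :> S * S; _ : frac.2 != 0 }.
HB.instance Definition _ := [isSub for frac].
HB.instance Definition _ := [Choice of ratio by <:].

Implicit Types x y z : ratio.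

Lemma domP x : x.2 != 0. Proof. by case: x. Qed.

Lemma dommulP x y : x.2 * y.2 != 0.
Proof. by rewrite semidom_mulf_neq0 ?domP. Qed.

Definition equivf x y := x.1 * y.2 == x.2 * y.1.

Lemma equivf_refl : reflexive equivf.
Proof. by move=> x; rewrite /equivf mulrC. Qed.

Lemma equivf_sym : symmetric equivf.
Proof. by move=> x y; rewrite /equivf eq_sym; congr (_==_); rewrite mulrC. Qed.

Lemma equivf_trans : transitive equivf.
Proof.
move=> [x Px] [y Py] [z Pz]; rewrite /equivf /= mulrC => /eqP xy /eqP yz.
by rewrite -(inj_eq (semidom_mulfI Px)) mulrA xy -mulrA yz mulrCA.
Qed.

Canonical equivf_equiv := EquivRel equivf equivf_refl equivf_sym equivf_trans.

Definition type := {eq_quot equivf}.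
HB.instance Definition _ : EqQuotient _ equivf type := EqQuotient.on type.
HB.instance Definition _ := Choice.on type.

Lemma equivf_def x y : x == y %[mod type] = (x.1 * y.2 == x.2 * y.1).
Proof. by rewrite eqmodE. Qed.

Lemma equivf_r x : x.1 * (repr (\pi_type x)).2 = x.2 * (repr (\pi_type x)).1.
Proof. by apply/eqP; rewrite -equivf_def reprK. Qed.

Lemma equivf_l x : (repr (\pi_type x)).1 * x.2 = (repr (\pi_type x)).2 * x.1.
Proof. by apply/eqP; rewrite -equivf_def reprK. Qed.

Definition ofS (a : S) : ratio := @MkRatio (a, 1) (oner_neq0 _).
Definition tofrac := lift_embed type ofS.
Canonical tofrac_pi_morph := PiEmbed tofrac.

Definition addf x y : ratio :=
  @MkRatio (x.1 * y.2 + y.1 * x.2, x.2 * y.2) (dommulP x y).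
Definition add := lift_op2 type addf.

Lemma pi_add : {morph \pi : x y / addf x y >-> add x y}.
Proof.
move=> x y; unlock add; apply/eqmodP; rewrite /= /equivf /=.
rewrite mulrDr mulrDl; apply/eqP.
symmetry; rewrite (AC (2*2) (3*1*2*4)) (AC (2*2) (3*2*1*4))/=.
by rewrite !equivf_l (ACl ((2*3)*(1*4))) (ACl ((2*3)*(4*1)))/=.
Qed.
Canonical pi_add_morph := PiMorph2 pi_add.

Definition mulf x y : ratio := @MkRatio (x.1 * y.1, x.2 * y.2) (dommulP x y).
Definition mul := lift_op2 type mulf.

Lemma pi_mul : {morph \pi : x y / mulf x y >-> mul x y}.
Proof.
move=> x y; unlock mul; apply/eqmodP; rewrite /= /equivf /=.
by rewrite mulrACA !equivf_r mulrACA.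
Qed.
Canonical pi_mul_morph := PiMorph2 pi_mul.

Lemma addA : associative add.
Proof.
elim/quotW=> x; elim/quotW=> y; elim/quotW=> z; rewrite !piE.
congr (\pi _); apply: val_inj; congr (_, _) => /=; last by rewrite mulrA.
by rewrite !mulrDl !mulrA !addrA ![_ * _ * x.2]mulrAC.
Qed.

Lemma addC : commutative add.
Proof.
elim/quotW=> x; elim/quotW=> y; rewrite !piE.
by congr (\pi _); apply: val_inj; rewrite /= addrC [y.2 * _]mulrC.
Qed.

Lemma add0_l : left_id (tofrac 0) add.
Proof.
elim/quotW=> x; rewrite !piE; congr (\pi _); apply: val_inj => /=.
by rewrite mul0r mul1r mulr1 add0r; case: x => -[].
Qed.

HB.instance Definition _ := Algebra.isNmodule.Build type addA addC add0_l.

Lemma mulA : associative mul.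
Proof.
elim/quotW=> x; elim/quotW=> y; elim/quotW=> z; rewrite !piE.
by congr (\pi _); apply: val_inj; rewrite /= !mulrA.
Qed.

Lemma mulC : commutative mul.
Proof.
elim/quotW=> x; elim/quotW=> y; rewrite !piE.
by congr (\pi _); apply: val_inj; rewrite /= mulrC [y.2 * _]mulrC.
Qed.

Lemma mul1_l : left_id (tofrac 1) mul.
Proof.
elim/quotW=> x; rewrite !piE; congr (\pi _); apply: val_inj => /=.
by rewrite !mul1r; case: x => -[].
Qed.

Lemma mul0_l : left_zero (tofrac 0) mul.
Proof.
by elim/quotW=> x; rewrite !piE; apply/eqmodP; rewrite /= /equivf /= !mul0r mulr0.
Qed.

Lemma mul_addl : left_distributive mul add.
Proof.
elim/quotW=> x; elim/quotW=> y; elim/quotW=> z; apply/eqP.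
rewrite !piE /equivf /=; apply/eqP.
rewrite !(mulrDr, mulrDl) (AC (3*(2*2)) (4*2*7*((1*3)*(6*5))))/=.
by rewrite [X in _ + X](AC (3*(2*2)) (4*6*7*((1*3)*(2*5))))/=.
Qed.

Lemma nonzero1 : tofrac 1 != tofrac 0 :> type.
Proof. by rewrite piE /equivf /= !mul1r oner_eq0. Qed.

HB.instance Definition _ := GRing.Nmodule_isComNzSemiRing.Build type
  mulA mulC mul1_l mul_addl mul0_l nonzero1.

Lemma tofrac_is_nmod_morphism : nmod_morphism tofrac.
Proof.
split=> // a b; rewrite -[RHS]/(add _ _) !piE; apply/eqmodP.
by rewrite /= /equivf /= !mulr1 mul1r.
Qed.
HB.instance Definition _ :=
  GRing.isNmodMorphism.Build S type tofrac tofrac_is_nmod_morphism.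

Lemma tofrac_is_monoid_morphism : monoid_morphism tofrac.
Proof.
split=> // a b; rewrite -[RHS]/(mul _ _) !piE; apply/eqmodP.
by rewrite /= /equivf /= !mulr1 mul1r.
Qed.
HB.instance Definition _ :=
  GRing.isMonoidMorphism.Build S type tofrac tofrac_is_monoid_morphism.

Lemma tofrac_inj : injective tofrac.
Proof.
by move=> a b /eqP; rewrite piE /equivf /= mulr1 mul1r => /eqP.
Qed.

Lemma tofrac_surj (u : type) :
  exists a d : S, d != 0 /\ u * tofrac d = tofrac a.
Proof.
elim/quotW: u => x; exists x.1, x.2; split; first exact: domP.
rewrite -[LHS]/(mul _ _) !piE; apply/eqmodP.
by rewrite /= /equivf /= !mulr1 mulrC.
Qed.

Lemma tofrac_unit (d : S) : d != 0 -> exists u : type, u * tofrac d = 1.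
Proof.
move=> d0; exists (\pi_type (@MkRatio (1, d) d0)).
rewrite -[RHS]/(tofrac 1) -[LHS]/(mul _ _) !piE; apply/eqmodP.
by rewrite /= /equivf /= !mulr1 !mul1r.
Qed.

End SemiFrac.
End SemiFrac.
HB.export SemiFrac.

Notation semifrac := SemiFrac.type.
Notation tofrac := (@SemiFrac.tofrac _).

(* M[X], a polynomial being the finitely supported sequence of its            *)
(* coefficients.                                                              *)
Definition mpol (M : nmodType) : Type := {fsfun nat -> M with 0}.

Section MPolNmodule.
Context (M : nmodType).
HB.instance Definition _ := Choice.on (mpol M).

Definition mkmpol (n : nat) (E : nat -> M) : mpol M :=
  [fsfun k in [fset j | j in iota 0 n]%fset => E k | 0].

Lemma coef_mkmpol n E k : mkmpol n E k = if (k < n)%N then E k else 0.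
Proof. by rewrite fsfunE !inE /= mem_iota add0n. Qed.

Definition msize (g : mpol M) : nat := \max_(k <- finsupp g) k.+1.

Lemma msize_coef (g : mpol M) k : (msize g <= k)%N -> g k = 0.
Proof.
move=> gk; case: (finsuppP g k) => // kg.
have : (k < msize g)%N by rewrite /msize (big_rem k) //= leq_maxl.
by rewrite ltnNge gk.
Qed.

Definition mpol_add (g h : mpol M) : mpol M :=
  mkmpol (maxn (msize g) (msize h)) (fun k => g k + h k).

Lemma mpol_addE g h k : mpol_add g h k = g k + h k.
Proof.
rewrite coef_mkmpol; case: ltnP => //; rewrite geq_max => /andP[gk hk].
by rewrite !msize_coef ?addr0.
Qed.

Lemma mpol_addA : associative mpol_add.
Proof. by move=> f g h; apply/fsfunP => k; rewrite !mpol_addE addrA. Qed.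

Lemma mpol_addC : commutative mpol_add.
Proof. by move=> f g; apply/fsfunP => k; rewrite !mpol_addE addrC. Qed.

Lemma mpol_add0 : left_id ([fsfun] : mpol M) mpol_add.
Proof. by move=> f; apply/fsfunP => k; rewrite !mpol_addE fsfun0E add0r. Qed.

HB.instance Definition _ :=
  Algebra.isNmodule.Build (mpol M) mpol_addA mpol_addC mpol_add0.

Lemma coef_mpolD (g h : mpol M) k : (g + h) k = g k + h k.
Proof. exact: mpol_addE. Qed.

Lemma coef_mpol0 k : (0 : mpol M) k = 0.
Proof. exact: fsfun0E. Qed.
End MPolNmodule.

Section MPolSemimodule.
Context (S : comNzSemiRingType) (M : lSemiModType S).
Implicit Types (f : {poly S}) (g : mpol M).

Definition mpol_scale f g : mpol M :=
  mkmpol (size f + msize g) (fun k => \sum_(i < k.+1) f`_i *: g (k - i)%N).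

Lemma mpol_scaleE f g k :
  mpol_scale f g k = \sum_(i < k.+1) f`_i *: g (k - i)%N.
Proof.
rewrite coef_mkmpol; case: ltnP => // fgk; rewrite big1 // => i _.
case: (ltnP i (size f)) => fi; last by rewrite nth_default ?scale0r.
have ik : (i <= k)%N by rewrite -ltnS.
rewrite msize_coef ?scaler0 // -(leq_add2l i) subnKC //.
by rewrite (leq_trans _ fgk) // leq_add2r ltnW.
Qed.

Lemma mpol_scaleE_rev f g k :
  mpol_scale f g k = \sum_(i < k.+1) f`_(k - i) *: g i.
Proof.
rewrite mpol_scaleE (reindex_inj rev_ord_inj) /=.
by apply: eq_bigr => i _; rewrite subSS subKn // -ltnS.
Qed.

Lemma mpol_scaleA f f' g :
  mpol_scale f (mpol_scale f' g) = mpol_scale (f * f') g.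
Proof.
apply/fsfunP => k; rewrite mpol_scaleE mpol_scaleE_rev.
pose coef3 i j := f`_i *: (f'`_(k - i - j) *: g j).
transitivity (\sum_(i < k.+1) \sum_(j < k.+1 | (j <= k - i)%N) coef3 i j).
  apply: eq_bigr => /= i _; rewrite mpol_scaleE_rev scaler_sumr.
  by rewrite (big_ord_narrow_leq (leq_subr _ _)).
rewrite (exchange_big_dep predT) //=; apply: eq_bigr => j _.
transitivity (\sum_(i < k.+1 | (i <= k - j)%N) coef3 i j).
  apply: eq_bigl => i; rewrite -ltnS -(ltnS i) -!subSn ?leq_ord //.
  by rewrite -subn_gt0 -(subn_gt0 i) -!subnDA addnC.
rewrite (big_ord_narrow_leq (leq_subr _ _)) coefM scaler_suml.
by apply: eq_bigr => i _; rewrite /coef3 -!subnDA addnC scalerA.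
Qed.

Lemma mpol_scale1 : left_id 1 mpol_scale.
Proof.
move=> g; apply/fsfunP => k; rewrite mpol_scaleE big_ord_recl subn0 coef1 scale1r.
by rewrite big1 ?addr0 // => i _; rewrite coef1 scale0r.
Qed.

Lemma mpol_scale0 g : mpol_scale 0 g = 0.
Proof.
apply/fsfunP => k; rewrite mpol_scaleE coef_mpol0 big1 // => i _.
by rewrite coef0 scale0r.
Qed.

Lemma mpol_scaleDr : right_distributive mpol_scale +%R.
Proof.
move=> f g h; apply/fsfunP => k; rewrite coef_mpolD !mpol_scaleE -big_split.
by apply: eq_bigr => i _; rewrite coef_mpolD scalerDr.
Qed.

Lemma mpol_scaleDl g : {morph mpol_scale^~ g : f f' / f + f'}.
Proof.
move=> f f'; apply/fsfunP => k; rewrite coef_mpolD !mpol_scaleE -big_split.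
by apply: eq_bigr => i _; rewrite coefD scalerDl.
Qed.

HB.instance Definition _ := GRing.Nmodule_isLSemiModule.Build {poly S} (mpol M)
  mpol_scaleA mpol_scale0 mpol_scale1 mpol_scaleDr mpol_scaleDl.

Lemma coef_mpolZ f g k : (f *: g) k = \sum_(i < k.+1) f`_i *: g (k - i)%N.
Proof. exact: mpol_scaleE. Qed.
End MPolSemimodule.

Definition finite_sums (U V : Type) (W : nmodType) (op : U -> V -> W)
    (A : set U) (B : set V) : set W :=
  [set w | exists n (a : 'I_n -> U) (b : 'I_n -> V),
     [/\ forall i, A (a i), forall i, B (b i) & w = \sum_(i < n) op (a i) (b i)]].

Section Ideals.
Context (S : comNzSemiRingType).

Definition is_ideal (I : set S) : Prop :=
  [/\ I !=set0, forall a b, I a -> I b -> I (a + b)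
    & forall s a, I a -> I (s * a)].

Definition ideal_generated (A : set S) : set S := smallest is_ideal A.

Definition finitely_generated (I : set S) : Prop :=
  exists s : seq S, I = ideal_generated [set` s].

Definition poly_content (f : {poly S}) : set S :=
  ideal_generated (range (fun i : nat => f`_i)).
End Ideals.

Section Semimodules.
Context (S : comNzSemiRingType) (M : lSemiModType S).

Definition is_subsemimodule (N : set M) : Prop :=
  [/\ N 0, forall x y, N x -> N y -> N (x + y)
    & forall s x, N x -> N (s *: x)].

Definition subtractive_subsemimodule (N : set M) : Prop :=
  forall x y, N (x + y) -> N x -> N y.

Definition subtractive : Prop :=
  forall N, is_subsemimodule N -> subtractive_subsemimodule N.

Definition mpol_content (g : mpol M) : set M :=
  smallest is_subsemimodule (range (g : nat -> M)).

Definition ideal_scale (I : set S) (N : set M) : set M :=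
  finite_sums *:%R I N.

Definition gaussian : Prop :=
  forall (f : {poly S}) (g : mpol M),
    mpol_content (f *: g) = ideal_scale (poly_content f) (mpol_content g).
End Semimodules.
Arguments subtractive {S} M.
Arguments gaussian S M : clear implicits.

Section FractionalIdeals.
Context (S : semidomainType).

Definition is_fractional_ideal (A : set (semifrac S)) : Prop :=
  [/\ A !=set0,
      forall x y, A x -> A y -> A (x + y),
      forall s x, A x -> A (tofrac s * x)
    & exists2 d : S, d != 0 &
        forall x, A x -> range tofrac (tofrac d * x)].

Definition invertible (A : set (semifrac S)) : Prop :=
  exists2 B, is_fractional_ideal B & finite_sums *%R A B = range tofrac.

Definition prufer : Prop :=
  forall I : set S, is_ideal I -> finitely_generated I -> I <> [set 0] ->
    invertible (tofrac @` I).

Definition dedekind : Prop :=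
  forall A : set (semifrac S), is_fractional_ideal A -> A <> [set 0] ->
    invertible A.
End FractionalIdeals.
Arguments prufer S : clear implicits.
Arguments dedekind S : clear implicits.

(* Main.v *)
(* Write N = c(fg) and a_i for the coefficients of f.  As c(f) is invertible,
   there are e_ji in S with e_jj a_i = a_j e_ji and \sum_j e_jj = 1, so that
   e_jj f = a_j e_j for e_j = \sum_i e_ji X^i.  Hence e_j * (a_j g) has its
   coefficients in N, and a McCoy-type induction, in which subtractivity
   replaces subtraction, shows that a power of each coefficient of e_j maps
   a_j g into N.  In particular a power of e_jj maps a_i b_k into N for every
   coefficient b_k of g; as the e_jj sum to 1, a_i b_k is in N. *)
Require Import Defs.
From HB Require Import structures.
From mathcomp Require Import all_boot all_algebra finmap all_classical.

Set Implicit Arguments.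
Unset Strict Implicit.
Unset Printing Implicit Defensive.

Import GRing.Theory.
Local Open Scope classical_set_scope.
Local Open Scope ring_scope.

(** * Scalars with a power that maps into a subsemimodule *)

Section Subsemimodule.
Context (S : comNzSemiRingType) (M : lSemiModType S).
Implicit Types (N : set M) (f : {poly S}) (g : mpol M).

Lemma subsemimodule_sum N (I : Type) (r : seq I) (P : pred I) (F : I -> M) :
  is_subsemimodule N -> (forall i, P i -> N (F i)) ->
  N (\sum_(i <- r | P i) F i).
Proof. by case=> N0 ND _ NF; apply: big_ind. Qed.

(** The index type does not depend on [k], which matches the sums in [subtractive_mccoy]. *)
Lemma coef_mpolZ_size f g k :
  (f *: g) k = \sum_(i < size f | (i <= k)%N) f`_i *: g (k - i)%N.
Proof.
pose F i := f`_i *: g (k - i)%N.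
rewrite coef_mpolZ (big_ord_widen _ F (leq_addl (size f) k.+1)).
rewrite (big_ord_widen_cond _ (fun i => i <= k)%N F (leq_addr k.+1 (size f))).
rewrite [LHS]big_mkcond [RHS]big_mkcond; apply: eq_bigr => i _; rewrite ltnS.
case: (leqP i k) => //= ik; case: (ltnP i (size f)) => //= fi.
by rewrite /F nth_default ?scale0r.
Qed.

(* The hypotheses say that the polynomial with coefficients [a 0, .., a n.-1]
   multiplies [h] into [N]; [h] has degree less than [m] modulo [N]. *)
Lemma subtractive_mccoy N (a : nat -> S) : is_subsemimodule N ->
  subtractive_subsemimodule N -> forall n m (h : nat -> M),
  (forall k, (m <= k)%N -> N (h k)) ->
  (forall k, N (\sum_(i < n | (i <= k)%N) a i *: h (k - i)%N)) ->
  forall j, (j < n)%N -> exists L, forall k, N (a j ^+ L *: h k).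
Proof.
move=> subN sbtN; have [N0 ND NZ] := subN.
elim=> [//|n IHn]; elim=> [|m IHm] h hN fhN j jn.
  by exists 0%N => k; rewrite expr0 scale1r; apply: hN.
(* In degree n + m every term but the last involves a value of [h] at an index above m, hence lies
   in [N]; subtractivity isolates the last. *)
have anhm : N (a n *: h m).
  have := fhN (n + m)%N; rewrite big_mkcond big_ord_recr /= leq_addr addKn.
  move/sbtN; apply; apply: subsemimodule_sum => // i _.
  case: ifP => // _; apply/NZ/hN.
  by rewrite -addnBAC ?(ltnW (ltn_ord i)) // -add1n leq_add2r subn_gt0.
(* Thus a_n h has degree less than m modulo [N], and the inner induction applies to it. *)
have [| |L LN] := IHm (fun k => a n *: h k) _ _ j jn.
- move=> k; rewrite leq_eqVlt => /predU1P[<- //|mk].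
  exact/NZ/hN.
- move=> k; have := NZ (a n) _ (fhN k).
  rewrite scaler_sumr; congr N; apply: eq_bigr => i _.
  by rewrite !scalerA mulrC.
move: jn; rewrite ltnS leq_eqVlt => /predU1P[jn|jn].
  by exists L.+1 => k; rewrite exprSr -scalerA {2}jn.
(* Since a_j^L a_n h lies in [N], subtractivity drops the top term of the sums for a_j^L h, leaving
   only n coefficients. *)
have [| |L' L'N] := IHn m.+1 (fun k => a j ^+ L *: h k) _ _ j jn.
- by move=> k mk; apply/NZ/hN.
- move=> k; have anN : N (a j ^+ L *: (if (n <= k)%N then a n *: h (k - n)%N else 0)).
    by case: ifP => _; rewrite ?scaler0.
  have := NZ (a j ^+ L) _ (fhN k).
  rewrite big_mkcond big_ord_recr -big_mkcond /= scalerDr addrC => /sbtN/(_ anN).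
  rewrite scaler_sumr; congr N; apply: eq_bigr => i _.
  by rewrite !scalerA mulrC.
by exists (L' + L)%N => k; rewrite exprD -scalerA.
Qed.

(** As for radicals of ideals: by the binomial theorem every term of (s + u)^(L + K) is divisible by
    s^L or by u^K. *)
Lemma radical_conductor_sum N (x : M) (I : Type) (r : seq I) (t : I -> S) :
  is_subsemimodule N -> (forall i, exists L, N (t i ^+ L *: x)) ->
  exists L, N ((\sum_(i <- r) t i) ^+ L *: x).
Proof.
move=> subN tN; have [N0 _ NZ] := subN.
elim/big_ind: _ => [|s u [L Ls] [K Ku]|i _]; last exact: tN.
  by exists 1%N; rewrite expr1 scale0r.
exists (L + K)%N; rewrite exprDn scaler_suml; apply: subsemimodule_sum => // i _.
rewrite -mulr_natl -scalerA; apply: (NZ).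
have [Ki|iK] := leqP K i.
  by rewrite -(subnK Ki) exprD mulrA -scalerA; apply: NZ.
by rewrite -addnBA ?(ltnW iK) // exprD mulrC mulrCA mulrC -scalerA; apply: NZ.
Qed.

(** * Contents and their products *)

Lemma mpol_content_subsemimodule g : is_subsemimodule (mpol_content g).
Proof.
split=> [A [] [] //|x y Nx Ny A sA|s x Nx A sA].
- by have [[_ D _] _] := sA; apply: D; [apply: Nx | apply: Ny].
- by have [[_ _ Z] _] := sA; apply: Z; apply: Nx.
Qed.

Lemma coef_mpol_content g k : mpol_content g (g k).
Proof. by move=> A [_]; apply; exists k. Qed.

Lemma mpol_content_min g N : is_subsemimodule N -> (forall k, N (g k)) ->
  mpol_content g `<=` N.
Proof. by move=> sN gN x; apply; split=> // _ [k _ <-]. Qed.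

Lemma poly_content_is_ideal f : is_ideal (poly_content f).
Proof.
split=> [|x y Nx Ny A sA|s x Nx A sA].
- by exists f`_0 => A [_]; apply; exists 0%N.
- by have [[_ D _] _] := sA; apply: D; [apply: Nx | apply: Ny].
- by have [[_ _ Z] _] := sA; apply: Z; apply: Nx.
Qed.

Lemma coef_poly_content f i : poly_content f f`_i.
Proof. by move=> A [_]; apply; exists i. Qed.

Lemma poly_content_min f (I : set S) : is_ideal I -> (forall k, I f`_k) ->
  poly_content f `<=` I.
Proof. by move=> sI fI x; apply; split=> // _ [k _ <-]. Qed.

Lemma poly_content_finitely_generated f : finitely_generated (poly_content f).
Proof.
(* The range of coefficients also contains the default 0 beyond the degree. *)
exists (0 :: f); rewrite /poly_content /ideal_generated; apply/seteqP; split.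
  move=> x fx A [iA sA]; apply: fx; split=> // _ [i _ <-]; apply: sA => /=.
  have [fi|fi] := leqP (size f) i; first by rewrite nth_default // mem_head.
  by rewrite inE mem_nth ?orbT.
move=> x fx A [iA sA]; apply: fx; split=> // y /=.
rewrite inE => /predU1P[->|/(nthP 0)[i _ <-]]; apply: sA.
  by exists (size f); rewrite ?nth_default.
by exists i.
Qed.

Lemma poly_contentE f x : poly_content f x ->
  exists s : 'I_(size f) -> S, x = \sum_i s i * f`_i.
Proof.
pose I := [set y | exists s : 'I_(size f) -> S, y = \sum_i s i * f`_i].
apply: (@poly_content_min f I) => [|k].
  split=> [|_ _ [s ->] [t ->]|u _ [s ->]].
  - by exists (\sum_(i < size f) 0 * f`_i), (fun=> 0).
  - exists (fun i => s i + t i); rewrite -big_split.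
    by apply: eq_bigr => i _; rewrite mulrDl.
  - exists (fun i => u * s i); rewrite mulr_sumr.
    by apply: eq_bigr => i _; rewrite mulrA.
have [fk|kf] := leqP (size f) k.
  by exists (fun=> 0); rewrite nth_default // big1 // => i _; rewrite mul0r.
exists (fun i => (i == Ordinal kf)%:R).
rewrite (bigD1 (Ordinal kf)) //= eqxx mul1r big1 ?addr0 // => i /negPf ->.
by rewrite mul0r.
Qed.

Lemma ideal_scale_subsemimodule (I : set S) N : is_ideal I ->
  is_subsemimodule (ideal_scale I N).
Proof.
move=> [_ _ IM]; split=> [|_ _ [n [a [b [aI bN ->]]]] [n' [a' [b' [aI' bN' ->]]]]|].
- by exists 0%N, (fun=> 0), (fun=> 0); rewrite big_ord0; split=> // -[].
- pose c (T : Type) (u : 'I_n -> T) (u' : 'I_n' -> T) (i : 'I_(n + n')) :=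
    match fintype.split i with inl j => u j | inr j => u' j end.
  exists (n + n')%N, (c _ a a'), (c _ b b'); split.
  + by move=> i; rewrite /c; case: (fintype.split i).
  + by move=> i; rewrite /c; case: (fintype.split i).
  + rewrite big_split_ord; congr (_ + _); apply: eq_bigr => i _.
      by rewrite /c (unsplitK (inl i)).
    by rewrite /c (unsplitK (inr i)).
- move=> s _ [n [a [b [aI bN ->]]]]; exists n, (fun i => s * a i), b.
  split=> // [i|]; first exact: IM.
  by rewrite scaler_sumr; apply: eq_bigr => i _; rewrite scalerA.
Qed.

Lemma mpol_contentZ_sub f g :
  mpol_content (f *: g) `<=` ideal_scale (poly_content f) (mpol_content g).
Proof.
have sI := @ideal_scale_subsemimodule _ (mpol_content g) (poly_content_is_ideal f).
apply: mpol_content_min => // k; rewrite coef_mpolZ; apply: subsemimodule_sum => // i _.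
exists 1%N, (fun=> f`_i), (fun=> g (k - i)%N); rewrite big_ord1.
by split=> // _; [apply: coef_poly_content | apply: coef_mpol_content].
Qed.

(** Two conductor arguments reduce to products of coefficients: the scalars carrying all
    coefficients of [g] into [N] form an ideal, and the elements that a fixed scalar carries into
    [N] form a subsemimodule. *)
Lemma ideal_scale_content_sub f g N : is_subsemimodule N ->
  (forall i k, N (f`_i *: g k)) ->
  ideal_scale (poly_content f) (mpol_content g) `<=` N.
Proof.
move=> sN fgN _ [n [a [b [aI bN ->]]]]; have [N0 ND NZ] := sN.
apply: subsemimodule_sum => // l _.
have /poly_content_min : is_ideal [set s : S | forall k, N (s *: g k)].
  split=> [|s t sg tg k|s t tg k].
  - by exists 0 => k; rewrite scale0r.
  - by rewrite scalerDl; apply: ND.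
  - by rewrite -scalerA; apply: NZ.
move=> /(_ _ fgN _ (aI l)) /= alg.
have /mpol_content_min : is_subsemimodule [set x | N (a l *: x)].
  split=> [|x y|s x] /=; first by rewrite scaler0.
  - by rewrite scalerDr; apply: ND.
  - by rewrite scalerA mulrC -scalerA; apply: NZ.
by move=> /(_ _ alg _ (bN l)).
Qed.

End Subsemimodule.

(** * Invertibility of contents *)

Section InvertibleContent.
Context (S : semidomainType).
Implicit Type f : {poly S}.
(* The algebra library's [tofrac] would otherwise shadow this one. *)
Local Notation tofrac := (@SemiFrac.tofrac S).

(** With denominator 1; this makes the Dedekind hypothesis applicable to contents. *)
Lemma image_tofrac_fractional (I : set S) :
  is_ideal I -> is_fractional_ideal (tofrac @` I).
Proof.
move=> [[x Ix] ID IM]; split.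
- by exists (tofrac x), x.
- by move=> _ _ [a Ia <-] [b Ib <-]; exists (a + b); rewrite ?rmorphD //; apply: ID.
- by move=> s _ [a Ia <-]; exists (s * a); rewrite ?rmorphM //; apply: IM.
- by exists 1; rewrite ?oner_neq0 // => _ [a _ <-]; exists a; rewrite ?rmorph1 ?mul1r.
Qed.

Lemma poly_content_invertible f : prufer S \/ dedekind S -> f != 0 ->
  invertible (tofrac @` poly_content f).
Proof.
move=> pd f0; have iI := poly_content_is_ideal f.
have lcI : poly_content f (lead_coef f) by apply: coef_poly_content.
have lc0 : lead_coef f != 0 by rewrite lead_coef_eq0.
case: pd => [p|d].
  apply: p => // [|E]; first exact: poly_content_finitely_generated.
  by move: lcI lc0; rewrite E /= => ->; rewrite eqxx.
apply: d => [|E]; first exact: image_tofrac_fractional.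
have : (tofrac @` poly_content f) (tofrac (lead_coef f)) by exists (lead_coef f).
rewrite E /= -(rmorph0 (tofrac : S -> _)) => /SemiFrac.tofrac_inj /eqP.
by rewrite (negPf lc0).
Qed.

(** Choose z_j in the inverse [B] with \sum_j z_j a_j = 1 and put e_ji = z_j a_i, which lies in S
    because c(f)[B] = S. Both sides of the last identity are then z_j a_j a_i. *)
Lemma invertible_content_witness f : invertible (tofrac @` poly_content f) ->
  exists e : 'I_(size f) -> nat -> S,
    \sum_j e j j = 1 /\ forall j i, e j j * f`_i = f`_j * e j i.
Proof.
case=> B fB IB; have [_ BD BZ _] := fB.
have [n [x [y [xI yB xy1]]]] : finite_sums *%R (tofrac @` poly_content f) B 1.
  by rewrite IB; exists 1; rewrite ?rmorph1.
have [z [zB z1]] : exists z : 'I_(size f) -> semifrac S,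
    (forall j, B (z j)) /\ \sum_j z j * tofrac f`_j = 1.
  have /choice[s sE] : forall l, exists s : 'I_(size f) -> S,
      x l = tofrac (\sum_i s i * f`_i).
    by move=> l; have [a /poly_contentE[s ->] <-] := xI l; exists s.
  (* Substitute x_l = \sum_j s_lj a_j in 1 = \sum_l x_l y_l and collect the factor of a_j. *)
  exists (fun j => \sum_l tofrac (s l j) * y l); split=> [j|].
    apply: (big_ind B) => // [|l _]; last exact: BZ.
    (* Fractional ideals are only required to be nonempty, so 0 is obtained as a multiple of some
       [b]. *)
    by have [[b Bb] _ _ _] := fB; have := BZ 0 b Bb; rewrite rmorph0 mul0r.
  rewrite xy1 (eq_bigr _ (fun j _ => mulr_suml _ _ _ _)) exchange_big.
  apply: eq_bigr => l _; rewrite sE rmorph_sum mulr_suml; apply: eq_bigr => j _.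
  by rewrite rmorphM mulrAC.
have eE j i : exists c : S, tofrac c = z j * tofrac f`_i.
  have [c _ <-] : range tofrac (z j * tofrac f`_i); last by exists c.
  rewrite -IB; exists 1%N, (fun=> tofrac f`_i), (fun=> z j).
  rewrite big_ord1 mulrC; split=> // _.
  by exists f`_i => //; apply: coef_poly_content.
have /choice[e {}eE] : forall j, exists c : nat -> S,
    forall i, tofrac (c i) = z j * tofrac f`_i.
  by move=> j; have /choice[c cE] := eE j; exists c.
exists e; split=> [|j i]; apply: SemiFrac.tofrac_inj.
  rewrite rmorph_sum rmorph1 -z1; apply: eq_bigr => j _; exact: eE.
by rewrite !rmorphM /= !eE mulrAC mulrC.
Qed.

End InvertibleContent.

Theorem theorem4p6 (S : semidomainType) (M : lSemiModType S) :
  prufer S \/ dedekind S -> subtractive M -> gaussian S M.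
Proof.
move=> pd subM f g; apply/seteqP; split; first exact: mpol_contentZ_sub.
move: (mpol_content_subsemimodule (f *: g)) (@coef_mpol_content _ _ (f *: g)).
move: (mpol_content _) => N sN fgN; have [N0 _ NZ] := sN.
apply: ideal_scale_content_sub => // i k.
(* The zero content is not invertible. *)
have [f0|f0] := eqVneq f 0.
  by have -> : f`_i = 0 by [rewrite f0 coef0]; rewrite scale0r.
have [e [e1 eE]] := invertible_content_witness (poly_content_invertible pd f0).
have eN j : exists L, N (e j j ^+ L *: (f`_i *: g k)).
  have [||L LN] := subtractive_mccoy sN (subM _ sN) (n := size f) (m := msize g)
    (h := fun k => f`_j *: g k) (a := e j) _ _ (ltn_ord j).
  - by move=> l gl; rewrite msize_coef // scaler0.
  (* The coefficients of e_j (a_j g) are those of e_jj f g, as e_ji a_j = e_jj a_i. *)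
  - move=> l; have := NZ (e j j) _ (fgN l).
    rewrite coef_mpolZ_size scaler_sumr; congr N.
    by apply: eq_bigr => l' _; rewrite !scalerA eE mulrC.
  (* The extra factor e_jj turns a_i into a_j e_ji. *)
  exists L.+1; rewrite exprSr -scalerA [e j j *: _]scalerA eE mulrC.
  by rewrite -scalerA scalerA mulrC -scalerA; apply: NZ.
have [L] := radical_conductor_sum (index_enum 'I_(size f)) sN eN.
by rewrite e1 expr1n scale1r.
Qed.
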